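(* Let $\mathbf{i}$ be the imaginary unit, let $$S_8=\begin{bmatrix} 1 & 1 & 1 & 1 & 1 & 1 & 1 & 1 \\ 1 & -1 & \mathbf{i} & -\mathbf{i} & 1 & -1 & \mathbf{i} & -\mathbf{i} \\ 1 & -1 & -\mathbf{i} & \mathbf{i} & 1 & -1 & -\mathbf{i} & \mathbf{i} \\ 1 & 1 & -1 & -1 & \mathbf{i} & \mathbf{i} & -\mathbf{i} & -\mathbf{i} \\ 1 & \mathbf{i} & 1 & \mathbf{i} & -1 & -\mathbf{i} & -1 & -\mathbf{i} \\ 1 & -\mathbf{i} & 1 & -\mathbf{i} & -1 & \mathbf{i} & -1 & \mathbf{i} \\ 1 & -1 & -1 & 1 & -1 & 1 & 1 & -1 \\ 1 & 1 & -1 & -1 & -\mathbf{i} & -\mathbf{i} & \mathbf{i} & \mathbf{i} \end{bmatrix},$$ and for $(a,b,c,d)\in\mathbb{R}^4$ let $$R(a,b,c,d)=\begin{bmatrix} 0 & 0 & 0 & 0 & 0 & 0 & 0 & 0 \\ 0 & d & a & a-d & d & 0 & a-d & a \\ 0 & d & a & a-d & d & 0 & a-d & a \\ 0 & d & d & 0 & b & b-d & b-d & b \\ 0 & c & d & c-d & d & c-d & 0 & c \\ 0 & c & d & c-d & d & c-d & 0 & c \\ 0 & 0 & 0 & 0 & 0 & 0 & 0 & 0 \\ 0 & d & d & 0 & b & b-d & b-d & b \end{bmatrix}.$$ Let $S_8^{(4)}(a,b,c,d)$ be the $8\times 8$ matrix with entries $[S_8]_{j,l}\cdot e^{\mathbf{i}R(a,b,c,d)_{j,l}}$.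 Then $\{S_8^{(4)}(a,b,c,d):(a,b,c,d)\in\mathbb{R}^4\}$ is a maximal affine 4-parameter family of complex Hadamard matrices stemming from $S_8$; in particular $S_8^{(4)}(a,b,c,d)$ is a complex Hadamard matrix for every $(a,b,c,d)\in\mathbb{R}^4$. Moreover, the members of this family lying in a sufficiently small neighbourhood of $S_8$ are not Dita-type.
   Context: A complex Hadamard matrix of order $r$ is an $r\times r$ complex matrix all of whose entries have absolute value $1$ and whose rows are pairwise orthogonal with respect to the standard Hermitian inner product. Two complex Hadamard matrices $K_1,K_2$ are equivalent if $K_1=D_1P_1K_2P_2D_2$ for some unitary diagonal matrices $D_1,D_2$ and permutation matrices $P_1,P_2$. A complex Hadamard matrix of order $N$ is called Dita-type if, for some integers $k,n\ge 2$ with $kn=N$, it is equivalent to a block matrix $$K=\begin{bmatrix} m_{11}N_1&\cdots&m_{1k}N_k\\ \vdots&&\vdots\\ m_{k1}N_1&\cdots&m_{kk}N_k\end{bmatrix},$$ where $M=(m_{ij})$ is some $k\times k$ complex Hadamard matrix and $N_1,\dots,N_k$ are some $n\times n$ complex Hadamard matrices (possibly different from each other). Let $H$ be an $N\times N$ complex Hadamard matrix whose first row and first column consist of $1$'s. An affine family stemming from $H$ is a set of complex Hadamard matrices of the form $\{(H_{j,l}\,e^{\mathbf{i}R_{j,l}})_{j,l}: R\in\mathcal{R}\}$, where $\mathcal{R}$ is a linear subspace of the real $N\times N$ matrices with zero first row and zero first column; the number of parameters is $\dim\mathcal{R}$. It is maximal if $\mathcal{R}$ is not properly contained in another such subspace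 that also gives an affine family of complex Hadamard matrices stemming from $H$. *)

(* Defs.v *)
(* The complex field is R[i] over an arbitrary R : realType. *)
From HB Require Import structures.
From mathcomp Require Import all_boot all_order all_fingroup all_algebra.
From mathcomp Require Import complex.
From mathcomp Require Import boolp classical_sets reals trigo.

Set Implicit Arguments.
Unset Strict Implicit.
Unset Printing Implicit Defensive.

Import Order.TTheory GRing.Theory Num.Theory.

Local Open Scope classical_set_scope.
Local Open Scope ring_scope.
Local Open Scope complex_scope.

(* e^{i t}, by Euler's formula. *)
Definition expi (R : realType) (t : R) : R[i] := cos t +i* sin t.

(* dotmx is the Hermitian product u *m v ^t* of row vectors. *)
Definition complex_hadamard (R : realType) (r : nat) (K : 'M[R[i]]_r) : Prop :=
  (forall i j, `|K i j| = 1) /\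
  (forall i j, i != j -> dotmx (row i K) (row j K) = 0).

Definition hadamard_equiv (R : realType) (r : nat) (K1 K2 : 'M[R[i]]_r) : Prop :=
  exists D1 D2 P1 P2 : 'M[R[i]]_r,
    [/\ is_diag_mx D1 && (D1 \is unitarymx),
        is_diag_mx D2 && (D2 \is unitarymx),
        is_perm_mx P1, is_perm_mx P2 &
        K1 = D1 *m P1 *m K2 *m P2 *m D2].

(* The order of a k x k block matrix with n x n blocks is, in the library,
   \sum_(i < k) n, which is only propositionally equal to k * n: the equation e
   states k * n = N in that form, and castmx transports along it. *)
Definition dita_type (R : realType) (N : nat) (K : 'M[R[i]]_N) : Prop :=
  exists (k n : nat) (e : (\sum_(i < k) n)%N = N)
         (M : 'M[R[i]]_k) (Ns : 'I_k -> 'M[R[i]]_n),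
    [/\ (2 <= k)%N, (2 <= n)%N, complex_hadamard M,
        forall j, complex_hadamard (Ns j) &
        hadamard_equiv K
          (castmx (e, e) (\mxblock_(i < k, j < k) (M i j *: Ns j)))].

(* The entrywise product of H and e^{i A}. *)
Definition phase_mul (R : realType) (N : nat)
    (H : 'M[R[i]]_N) (A : 'M[R]_N) : 'M[R[i]]_N :=
  \matrix_(j, l) (H j l * expi (A j l)).

Definition affine_set (R : realType) (N : nat)
    (H : 'M[R[i]]_N) (V : {vspace 'M[R]_N}) : set 'M[R[i]]_N :=
  [set phase_mul H A | A in [set` V]].

(* affine_family H V: the subspace V gives an affine family of complex Hadamard
   matrices stemming from H (whose underlying set is affine_set H V). *)
Definition affine_family (R : realType) (n : nat)
    (H : 'M[R[i]]_n.+1) (V : {vspace 'M[R]_n.+1}) : Prop :=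
  [/\ complex_hadamard H,
      forall j, H ord0 j = 1 /\ H j ord0 = 1,
      forall A, A \in V -> forall j, A ord0 j = 0 /\ A j ord0 = 0 &
      forall K, affine_set H V K -> complex_hadamard K].

Definition maximal_affine_family (R : realType) (n : nat)
    (H : 'M[R[i]]_n.+1) (V : {vspace 'M[R]_n.+1}) : Prop :=
  affine_family H V /\
  forall W : {vspace 'M[R]_n.+1},
    affine_family H W -> (V <= W)%VS -> W = V.

Definition mx8_of_rows (T : nmodType) (s : seq (seq T)) : 'M[T]_8 :=
  \matrix_(j < 8, l < 8) (nth [::] s j)`_l.

Definition S8 (R : realType) : 'M[R[i]]_8 :=
  let i : R[i] := 'i in
  mx8_of_rows
  [:: [:: 1;  1;  1;  1;  1;  1;  1;  1];
      [:: 1; -1;  i; -i;  1; -1;  i; -i];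
      [:: 1; -1; -i;  i;  1; -1; -i;  i];
      [:: 1;  1; -1; -1;  i;  i; -i; -i];
      [:: 1;  i;  1;  i; -1; -i; -1; -i];
      [:: 1; -i;  1; -i; -1;  i; -1;  i];
      [:: 1; -1; -1;  1; -1;  1;  1; -1];
      [:: 1;  1; -1; -1; -i; -i;  i;  i]].

Definition R8 (R : realType) (a b c d : R) : 'M[R]_8 :=
  mx8_of_rows
  [:: [:: 0; 0; 0; 0;     0; 0;     0;     0];
      [:: 0; d; a; a - d; d; 0;     a - d; a];
      [:: 0; d; a; a - d; d; 0;     a - d; a];
      [:: 0; d; d; 0;     b; b - d; b - d; b];
      [:: 0; c; d; c - d; d; c - d; 0;     c];
      [:: 0; c; d; c - d; d; c - d; 0;     c];
      [:: 0; 0; 0; 0;     0; 0;     0;     0];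
      [:: 0; d; d; 0;     b; b - d; b - d; b]].

Definition S8_4 (R : realType) (a b c d : R) : 'M[R[i]]_8 :=
  phase_mul (S8 R) (R8 a b c d).

Definition S8_4_family (R : realType) : set 'M[R[i]]_8 :=
  [set K | exists a b c d : R, K = S8_4 a b c d].
Arguments S8_4_family R : clear implicits.

(* Main.v *)
Require Import Defs.
From HB Require Import structures.
From mathcomp Require Import all_boot all_order all_fingroup all_algebra.
From mathcomp Require Import complex ring lra.
From mathcomp Require Import boolp classical_sets reals trigo.
From mathcomp Require Import functions topology normedtype derive realfun.

Set Implicit Arguments.
Unset Strict Implicit.
Unset Printing Implicit Defensive.

Import Order.TTheory GRing.Theory Num.Theory.
Import numFieldNormedType.Exports.

Local Open Scope classical_set_scope.
Local Open Scope ring_scope.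
Local Open Scope complex_scope.

(* The product of an entry of one row with the conjugate of the entry of another
   row in the same column is a power of i times the exponential of i times a
   linear form in (a, b, c, d), so each inner product of rows splits into groups
   of columns sharing the same form, and in each group the powers of i cancel in
   pairs.

   Maximality: if A lies in a larger affine family, differentiating at t = 0
   the inner products at the points t A + R8 a b c d, with a, b, c, d in {0, pi},
   and separating these sixteen equations by a discrete Fourier transform gives
   one linear equation in A per group of columns; these equations force A to be
   some R8 a b c d.

   Non-Dita: a Dita-type matrix of order 8 satisfies one of two systems of
   polynomial equations between 2 x 2 minors, up to the order of rows and columns.
   Powers of i that are close are equal, so a member of the family near S8
   satisfying them would make S8 satisfy them as well, which a finite check on the
   exponents excludes. *)

(** * Unit complex numbers and powers of i *)

Section Expi.
Variable R : realType.
Implicit Types x y : R.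

Lemma expi0 : expi 0 = 1 :> R[i].
Proof. by rewrite /expi cos0 sin0. Qed.

Lemma expiD x y : expi (x + y) = expi x * expi y.
Proof. by rewrite /expi cosD sinD; simpc; rewrite [sin x * cos y + _]addrC. Qed.

Lemma conjc_expi x : conjc (expi x) = expi (- x).
Proof. by rewrite /expi cosN sinN. Qed.

Lemma norm_expi x : `|expi x| = 1.
Proof. by rewrite normc_def /= cos2Dsin2 sqrtr1. Qed.

Lemma expi_sum n (F : 'I_n -> R) : expi (\sum_i F i) = \prod_i expi (F i).
Proof. exact: (big_morph _ expiD expi0). Qed.

Lemma expi_pi : expi pi = -1 :> R[i].
Proof. by rewrite /expi cospi sinpi; simpc. Qed.

Lemma expi_piz (m : int) : expi (pi *~ m) = (-1) ^+ `|m| :> R[i].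
Proof.
have expi_pin k : expi (pi *+ k) = (-1) ^+ k :> R[i].
  by elim: k => [|k IH]; rewrite ?expi0 // mulrS expiD IH expi_pi exprS.
case: m => k; first by rewrite -expi_pin.
rewrite NegzE mulrNz -conjc_expi -pmulrn expi_pin /=.
by rewrite rmorphXn rmorphN rmorph1.
Qed.

Lemma norm_i : `|'i%C : R[i]| = 1.
Proof. by rewrite normc_def /= expr0n expr1n add0r sqrtr1. Qed.

Lemma conjcM (x y : R[i]) : conjc (x * y) = conjc x * conjc y.
Proof. exact: rmorphM. Qed.

Lemma iX4 : ('i%C : R[i]) ^+ 4 = 1.
Proof. by rewrite -[4%N]/(2 * 2)%N exprM sqr_i sqrrN expr1n. Qed.

Lemma iX_mod n : ('i%C : R[i]) ^+ (n %% 4) = 'i%C ^+ n.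
Proof. by rewrite expr_mod // iX4. Qed.

Lemma conjc_iX n : conjc (('i%C : R[i]) ^+ n) = 'i%C ^+ (3 * n).
Proof.
rewrite rmorphXn exprM; congr (_ ^+ n).
by rewrite exprS sqr_i; simpc.
Qed.

(** Two distinct fourth roots of unity are at distance at least the square root of 2. Squared moduli
    reduce this to one numerical inequality for each of the sixteen pairs of residues. *)
Lemma eqmod_of_iX_close m n :
  `|('i%C : R[i]) ^+ m - 'i%C ^+ n| < 1 -> m = n %[mod 4].
Proof.
rewrite -(iX_mod m) -(iX_mod n).
have := ltn_pmod m (isT : (0 < 4)%N); have := ltn_pmod n (isT : (0 < 4)%N).
move: (m %% 4)%N (n %% 4)%N => {m n}.
have i3 : ('i%C : R[i]) ^+ 3 = - 'i%C by rewrite exprS sqr_i mulrN1.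
have lt1 (z : R[i]) : `|z| < 1 -> complex.Re z ^+ 2 + complex.Im z ^+ 2 < 1.
  rewrite normc_def -[X in _ < X -> _]/(1%:C) ltcR -[X in _ < X -> _]sqrtr1.
  by rewrite ltr_sqrt ?ltr01.
case=> [|[|[|[|?]]]]; case=> [|[|[|[|?]]]] //= _ _ /lt1;
  rewrite ?expr0 ?expr1 ?i3 ?sqr_i /= => h; exfalso; move: h; clear; lra.
Qed.

End Expi.

(** * Integer encoding of [S8] and [R8] *)

Definition S8_exponents : seq (seq nat) :=
  [:: [:: 0; 0; 0; 0; 0; 0; 0; 0]%N;
      [:: 0; 2; 1; 3; 0; 2; 1; 3]%N;
      [:: 0; 2; 3; 1; 0; 2; 3; 1]%N;
      [:: 0; 0; 2; 2; 1; 1; 3; 3]%N;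
      [:: 0; 1; 0; 1; 2; 3; 2; 3]%N;
      [:: 0; 3; 0; 3; 2; 1; 2; 1]%N;
      [:: 0; 2; 2; 0; 2; 0; 0; 2]%N;
      [:: 0; 0; 2; 2; 3; 3; 1; 1]%N].

(* Coordinates of the entries of [R8 a b c d] in the basis [a, b, c, d]. *)
Definition R8_forms : seq (seq (seq int)) :=
  let z := [:: 0; 0; 0; 0] in
  let a := [:: 1; 0; 0; 0] in let b := [:: 0; 1; 0; 0] in
  let c := [:: 0; 0; 1; 0] in let d := [:: 0; 0; 0; 1] in
  let ad := [:: 1; 0; 0; -1] in let bd := [:: 0; 1; 0; -1] in
  let cd := [:: 0; 0; 1; -1] in
  [:: [:: z; z; z; z; z; z; z; z];
      [:: z; d; a; ad; d; z; ad; a];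
      [:: z; d; a; ad; d; z; ad; a];
      [:: z; d; d; z; b; bd; bd; b];
      [:: z; c; d; cd; d; cd; z; c];
      [:: z; c; d; cd; d; cd; z; c];
      [:: z; z; z; z; z; z; z; z];
      [:: z; d; d; z; b; bd; bd; b]].

Definition S8_exp (j l : nat) : nat := nth 0%N (nth [::] S8_exponents j) l.
Definition R8_form (j l : nat) : seq int := nth [::] (nth [::] R8_forms j) l.

Definition form_sub (w w' : seq int) : seq int := mkseq (fun i => w`_i - w'`_i) 4.

Definition eval_form (R : realType) (w : seq int) (v : 'I_4 -> R) : R :=
  \sum_(i < 4) v i *~ w`_i.

(* The product of entry [(j, l)] of [S8 R] and of the conjugate of entry
   [(k, l)] is the power of i of this exponent, as conjugation cubes i. *)
Definition S8_quot_exp (j k l : nat) : nat := (S8_exp j l + 3 * S8_exp k l)%N.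

Definition R8_quot_form (j k l : nat) : seq int :=
  form_sub (R8_form j l) (R8_form k l).

(** Exponents are reduced modulo 4, so that equal summands of the inner product of rows [j] and [k]
    are equal as data. *)
Definition quot_terms (j k : nat) : seq (nat * seq int) :=
  [seq ((S8_quot_exp j k l %% 4)%N, R8_quot_form j k l) | l <- iota 0 8].

(** Transfers to ordinals a check over natural numbers that [vm_compute] can run. *)
Lemma all_ord8P (P : pred nat) : reflect (forall j : 'I_8, P j) (all P (iota 0 8)).
Proof.
apply: (iffP allP) => [h j|h j]; first by apply: h; rewrite mem_iota ltn_ord.
by rewrite mem_iota => j8; exact: (h (Ordinal j8)).
Qed.

(** Adding 2 to an exponent multiplies the term by -1: the multiset of terms of each inner product
    is stable under negation. *)
Lemma perm_quot_terms (j k : 'I_8) : j != k ->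
  perm_eq (quot_terms j k) [seq (((x.1 + 2) %% 4)%N, x.2) | x <- quot_terms j k].
Proof.
have h : all (fun j => all (fun k => (j == k) || perm_eq (quot_terms j k)
  [seq (((x.1 + 2) %% 4)%N, x.2) | x <- quot_terms j k]) (iota 0 8)) (iota 0 8).
  by vm_compute.
move: h => /all_ord8P/(_ j)/all_ord8P/(_ k)/orP[/eqP/val_inj->|//].
by rewrite eqxx.
Qed.

Definition R8_of (R : realType) (v : 'I_4 -> R) : 'M[R]_8 :=
  R8 (v 0) (v 1) (v 2%:R) (v 3%:R).

(** * The members of the family are Hadamard matrices *)

Section Family.
Variable R : realType.

Lemma S8E (j l : 'I_8) : S8 R j l = 'i%C ^+ S8_exp j l.
Proof.
have i3 : ('i%C : R[i]) ^+ 3 = - 'i%C by rewrite exprS sqr_i mulrN1.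
rewrite mxE.
rewrite [X in nth _ X j](_ : _ =
    map (map (fun e => 'i%C ^+ e : R[i])) S8_exponents);
  last by rewrite /= expr0 expr1 sqr_i i3.
rewrite (nth_map [::]) ?(nth_map 0%N) //.
by case: j => -[|[|[|[|[|[|[|[|//]]]]]]]] ?; case: l.
Qed.

Lemma R8_ofE (v : 'I_4 -> R) (j l : 'I_8) :
  R8_of v j l = eval_form (R8_form j l) v.
Proof.
have evalE (w : seq int) : eval_form w v =
    v 0 *~ w`_0 + v 1 *~ w`_1 + v 2%:R *~ w`_2 + v 3%:R *~ w`_3.
  rewrite /eval_form !big_ord_recl big_ord0 addr0 !addrA.
  by do !congr (_ + _); congr (v _ *~ _); apply: val_inj.
rewrite mxE.
rewrite [X in nth _ X j](_ : _ =
    map (map (fun w => eval_form w v)) R8_forms);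
  last rewrite /= !evalE /= ?mulrNz ?mulr1z ?mulr0z;
  last by rewrite !(add0r, addr0).
rewrite (nth_map [::]) ?(nth_map [::]) //.
by case: j => -[|[|[|[|[|[|[|[|//]]]]]]]] ?; case: l.
Qed.

Lemma eval_formB (v : 'I_4 -> R) w w' :
  eval_form (form_sub w w') v = eval_form w v - eval_form w' v.
Proof.
rewrite -sumrB; apply: eq_bigr => i _.
by rewrite nth_mkseq ?mulrzBr.
Qed.

Lemma dotmx_rowE m n (K : 'M[R[i]]_(m, n)) j k :
  dotmx (row j K) (row k K) = \sum_l K j l * conjc (K k l).
Proof. by rewrite dotmxE mxE; apply: eq_bigr => l _; rewrite !mxE. Qed.

Lemma dotmx_phase_mul (A : 'M[R]_8) (j k : 'I_8) :
  dotmx (row j (phase_mul (S8 R) A)) (row k (phase_mul (S8 R) A)) =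
  \sum_(l < 8) 'i%C ^+ S8_quot_exp j k l * expi (A j l - A k l).
Proof.
rewrite dotmx_rowE; apply: eq_bigr => l _.
rewrite 2![phase_mul _ _ _ _]mxE !S8E conjcM conjc_iX conjc_expi.
by rewrite /S8_quot_exp exprD expiD mulrACA.
Qed.

Lemma norm_phase_mul_S8 (A : 'M[R]_8) (j l : 'I_8) :
  `|phase_mul (S8 R) A j l| = 1.
Proof. by rewrite mxE S8E normrM normrX norm_i norm_expi expr1n mulr1. Qed.

Lemma complex_hadamard_R8 (v : 'I_4 -> R) :
  complex_hadamard (phase_mul (S8 R) (R8_of v)).
Proof.
split=> [j l|j k njk]; first exact: norm_phase_mul_S8.
rewrite dotmx_phase_mul.
pose F (x : nat * seq int) : R[i] := 'i%C ^+ x.1 * expi (eval_form x.2 v).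
have -> : \sum_(l < 8) 'i%C ^+ S8_quot_exp j k l * expi (R8_of v j l - R8_of v k l) =
          \sum_(x <- quot_terms j k) F x.
  rewrite big_map -[iota 0 8]/(index_iota 0 8) big_mkord.
  by apply: eq_bigr => l _; rewrite /F !R8_ofE -eval_formB iX_mod.
(* The sum is its own opposite: one of its two copies is reindexed by [perm_quot_terms] and cancels
   the other. *)
apply: (@mulfI _ 2%:R); rewrite ?pnatr_eq0 // mulr0 mulr_natl mulr2n.
rewrite {1}(perm_big _ (perm_quot_terms njk)) big_map -big_split /=.
apply: big1 => x _; rewrite /F /= iX_mod exprD sqr_i.
by rewrite mulrN1 mulNr addNr.
Qed.

End Family.

(** * First-order consequences of vanishing exponential sums *)

Section Derivative.
Variable R : realType.

(** The conclusion is the derivative at 0 of the function assumed to vanish; the cosine terms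
    contribute nothing to it. *)
Lemma sum_cos_sin_eq0 n (p q x : 'I_n -> R) :
  (forall t, \sum_i (p i * cos (x i * t) + q i * sin (x i * t)) = 0) ->
  \sum_i q i * x i = 0.
Proof.
move=> h0.
pose h (i : 'I_n) : R^o -> R^o :=
  p i *: (@cos R \o ( *%R (x i)) : R^o -> R^o) +
  q i *: (@sin R \o ( *%R (x i)) : R^o -> R^o).
have dM (y : R) : is_derive (0 : R) 1 ( *%R y) y.
  have := is_deriveZ y (is_derive_id (0 : R) (1 : R)).
  by rewrite /GRing.scale /= mulr1.
have dh i : is_derive (0 : R) 1 (h i) (q i * x i).
  have dc := @is_derive1_comp R (@cos R) ( *%R (x i)) 0 _ _ (is_derive_cos _) (dM _).
  have ds := @is_derive1_comp R (@sin R) ( *%R (x i)) 0 _ _ (is_derive_sin _) (dM _).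
  have := is_deriveD (is_deriveZ (p i) dc) (is_deriveZ (q i) ds).
  move/is_derive_eq; apply.
  by rewrite mulr0 sin0 cos0 oppr0 mul0r scaler0 add0r mul1r.
have := is_derive_sum dh.
have -> : \sum_(i < n) h i = cst 0.
  by apply/funext => t; rewrite fct_sumE -[RHS](h0 t).
by case=> _ <-; rewrite derive_cst.
Qed.

Lemma Re_sum (I : Type) (r : seq I) (F : I -> R[i]) :
  complex.Re (\sum_(i <- r) F i) = \sum_(i <- r) complex.Re (F i).
Proof. by apply: (big_morph (@complex.Re R)) => // -[? ?] []. Qed.

Lemma Im_sum (I : Type) (r : seq I) (F : I -> R[i]) :
  complex.Im (\sum_(i <- r) F i) = \sum_(i <- r) complex.Im (F i).
Proof. by apply: (big_morph (@complex.Im R)) => // -[? ?] []. Qed.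

Lemma sum_expi_eq0 n (c : 'I_n -> R[i]) (x : 'I_n -> R) :
  (forall t : R, \sum_i c i * expi (x i * t) = 0) -> \sum_i c i * (x i)%:C = 0.
Proof.
(* The imaginary part of [c * expi (x * t)] is Im c cos(x t) + Re c sin(x t), with derivative x Re c
   at 0. *)
have Im_eq0 (c' : 'I_n -> R[i]) : (forall t : R, \sum_i c' i * expi (x i * t) = 0) ->
    complex.Re (\sum_i c' i * (x i)%:C) = 0.
  move=> h0; rewrite Re_sum.
  rewrite -[RHS](@sum_cos_sin_eq0 n (fun i => complex.Im (c' i))
    (fun i => complex.Re (c' i)) x).
        by apply: eq_bigr => i _; case: (c' i) => u v /=; rewrite mulr0 subr0.
  move=> t; have /(congr1 (@complex.Im R)) := h0 t; rewrite Im_sum /= => h.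
  rewrite -[RHS]h.
  by apply: eq_bigr => i _; case: (c' i) => u v /=; rewrite addrC.
move=> h0; have re0 := Im_eq0 _ h0.
(* Multiplication by i moves the imaginary part, up to sign, to the real part. *)
have /Im_eq0 im0 : forall t : R, \sum_i ('i%C * c i) * expi (x i * t) = 0.
  by move=> t; under eq_bigr do rewrite -mulrA; rewrite -mulr_sumr h0 mulr0.
move: im0 re0; under eq_bigr do rewrite -mulrA; rewrite -mulr_sumr.
case: (\sum_i _) => u v /=; rewrite mul0r mul1r sub0r => /eqP.
by rewrite oppr_eq0 => /eqP -> ->.
Qed.

End Derivative.

(* At parameters in {0, pi} a form is only seen modulo 2; the columns of a class
   carry the same power of i as column [l0] (true) or the opposite one (false). *)
Definition same_parity (w w' : seq int) : bool :=
  all (fun i => ~~ odd (absz (form_sub w w')`_i)) (iota 0 4).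

Definition signed_class (j k l0 : nat) : seq (bool * nat) :=
  [seq ((S8_quot_exp j k l == S8_quot_exp j k l0 %[mod 4])%N, l) |
    l <- iota 0 8 & same_parity (R8_quot_form j k l) (R8_quot_form j k l0)].

(** * Separating the classes of columns by a discrete Fourier transform *)

Section Rigidity.
Variable R : realType.

Definition half_turn (eps : {ffun 'I_4 -> bool}) (i : 'I_4) : R :=
  if eps i then pi else 0.

(** Orthogonality of the characters of (Z/2)^4: the sum factors over the four coordinates, and a
    coordinate m contributes 1 + (-1)^m, that is 2 or 0. *)
Lemma sum_expi_half_turn (w w' : seq int) :
  \sum_(eps : {ffun 'I_4 -> bool})
    expi (eval_form (form_sub w w') (half_turn eps)) =
  if same_parity w w' then 16%:R else 0.
Proof.
pose g (i : 'I_4) (b : bool) : R[i] :=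
  expi ((if b then pi else 0) *~ (form_sub w w')`_i).
under eq_bigr => eps _ do rewrite expi_sum -/(\prod_i g i (eps i)).
rewrite -bigA_distr_bigA /=.
have gE i : \sum_b g i b = if odd (absz (form_sub w w')`_i) then 0 else 2%:R.
  rewrite big_bool /g expi_piz mul0rz expi0.
  by rewrite -signr_odd; case: odd; rewrite /= ?expr1 ?addNr.
under eq_bigr do rewrite gE.
rewrite !big_ord_recl big_ord0 /same_parity /= /bump /=.
by do 4!case: odd; rewrite ?(mul0r, mulr0, mulr1) // -!natrM.
Qed.

(** Checked on all rows and columns: within a class the exponents agree modulo 4 or differ by 2. *)
Lemma same_parity_exp (j k l l0 : 'I_8) :
  same_parity (R8_quot_form j k l) (R8_quot_form j k l0) ->
  'i%C ^+ S8_quot_exp j k l =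
  (-1) ^+ (S8_quot_exp j k l != S8_quot_exp j k l0 %[mod 4])%N *
  'i%C ^+ S8_quot_exp j k l0 :> R[i].
Proof.
have h : all (fun j => all (fun k => all (fun l => all (fun l0 =>
    same_parity (R8_quot_form j k l) (R8_quot_form j k l0) ==>
    (S8_quot_exp j k l == S8_quot_exp j k l0 + 2 *
     (S8_quot_exp j k l != S8_quot_exp j k l0 %[mod 4])%N %[mod 4])%N) (iota 0 8))
    (iota 0 8)) (iota 0 8)) (iota 0 8).
  by vm_compute.
move: h => /all_ord8P/(_ j)/all_ord8P/(_ k)/all_ord8P/(_ l)/all_ord8P/(_ l0)/implyP h.
move/h/eqP; move: (_ != _ %[mod 4])%N => b e.
by rewrite -[LHS]iX_mod e iX_mod exprD exprM sqr_i mulrC.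
Qed.

Lemma row_relation (A : 'M[R]_8) (j k l0 : 'I_8) : j != k ->
  (forall t v, complex_hadamard (phase_mul (S8 R) (t *: A + R8_of v))) ->
  \sum_(bl <- signed_class j k l0)
    (-1) ^+ (~~ bl.1) * (A j (inord bl.2) - A k (inord bl.2)) = 0.
Proof.
move=> njk HA.
pose x l := A j l - A k l.
(* Up to a factor i, this is the derivative at [t = 0] of the inner product of the two rows at
   [t *: A + R8_of v]. *)
have dot0 v : \sum_(l < 8) 'i%C ^+ S8_quot_exp j k l *
    expi (eval_form (R8_quot_form j k l) v) * (x l)%:C = 0.
  apply: sum_expi_eq0 => t; have [_ /(_ j k njk)] := HA t v.
  rewrite dotmx_phase_mul => h; rewrite -[RHS]h; apply: eq_bigr => l _.
  have BE m : (t *: A + R8_of v) m l = t * A m l + eval_form (R8_form m l) v.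
    by rewrite mxE -R8_ofE [X in X + _]mxE.
  by rewrite -mulrA -expiD !BE eval_formB /x; congr (_ * expi _); ring.
pose w0 := R8_quot_form j k l0.
(* Multiplying by the conjugate of the exponential of [w0] before summing over the sixteen points
   keeps exactly the columns whose form is congruent to [w0] modulo 2. *)
have : \sum_(eps : {ffun 'I_4 -> bool}) \sum_(l < 8) 'i%C ^+ S8_quot_exp j k l *
    (x l)%:C * expi (eval_form (form_sub (R8_quot_form j k l) w0) (half_turn eps)) = 0.
  apply: big1 => eps _.
  rewrite -[RHS](mulr0 (expi (- eval_form w0 (half_turn eps)))).
  rewrite -[in RHS](dot0 (half_turn eps)).
  rewrite mulr_sumr; apply: eq_bigr => l _; rewrite eval_formB expiD; ring.
rewrite exchange_big /=; under eq_bigr do rewrite -mulr_sumr sum_expi_half_turn.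
move=> sum0.
pose y (l : 'I_8) : R :=
  (-1) ^+ (S8_quot_exp j k l != S8_quot_exp j k l0 %[mod 4])%N * x l.
have : 'i%C ^+ S8_quot_exp j k l0 * 16%:R *
  (\sum_(l < 8 | same_parity (R8_quot_form j k l) w0) y l)%:C = 0.
  rewrite -[RHS]sum0 rmorph_sum mulr_sumr [LHS]big_mkcond; apply: eq_bigr => l _.
  case: ifP => [/same_parity_exp->|]; last by rewrite mulr0.
  by rewrite rmorphM rmorphXn rmorphN1; ring.
move/eqP; rewrite !mulf_eq0 expf_eq0 -normr_eq0 norm_i oner_eq0 andbF pnatr_eq0 /=.
move/eqP/(congr1 (@complex.Re R)) => /= y0.
rewrite -[RHS]y0 /signed_class big_map big_filter -[iota 0 8]/(index_iota 0 8).
by rewrite big_mkord; apply: eq_bigr => l _; rewrite inord_val.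
Qed.

End Rigidity.

(** * Solving the linear system for the entries *)

Definition entry (R : realType) (A : 'M[R]_8) (m n : nat) : R :=
  A (inord m) (inord n).

Section Entries.
Variables (R : realType) (A : 'M[R]_8).
Hypothesis A0 : forall j, A ord0 j = 0 /\ A j ord0 = 0.
Hypothesis HA :
  forall t v, complex_hadamard (phase_mul (S8 R) (t *: A + R8_of v)).

Local Notation B := (entry A).

Lemma entry_row0 l : B 0 l = 0.
Proof.
rewrite /entry (_ : inord 0 = ord0); first by case: (A0 (inord l)).
by apply: val_inj; rewrite /= inordK.
Qed.

Lemma entry_col0 j : B j 0 = 0.
Proof.
rewrite /entry (_ : inord 0 = ord0); first by case: (A0 (inord j)).
by apply: val_inj; rewrite /= inordK.
Qed.

(** The class is supplied as an explicit list [s] and confirmed by computation, so that the sum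
    unfolds into a concrete linear equation. *)
Lemma entry_relation j k l s : (j < 8)%N -> (k < 8)%N -> (l < 8)%N -> j != k ->
  signed_class j k l == s ->
  \sum_(bl <- s) (-1) ^+ (~~ bl.1) * (B j bl.2 - B k bl.2) = 0.
Proof.
move=> hj hk hl jk /eqP <-.
rewrite -[RHS](@row_relation R A (Ordinal hj) (Ordinal hk) (Ordinal hl) jk HA).
apply: eq_bigr => bl _; rewrite /entry.
by rewrite (_ : inord j = Ordinal hj) 1?(_ : inord k = Ordinal hk) //;
  apply: val_inj; rewrite /= inordK.
Qed.

(** The main tool of the elimination: a class of two columns carrying opposite powers of i. *)
Lemma entry_pair j k l l' : (j < 8)%N -> (k < 8)%N -> (l < 8)%N -> j != k ->
  signed_class j k l == [:: (true, l); (false, l')] ->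
  B j l - B k l = B j l' - B k l'.
Proof.
move=> hj hk hl jk /(entry_relation hj hk hl jk).
rewrite unlock /= expr0 expr1 mul1r mulN1r addr0.
by move/eqP; rewrite subr_eq0 => /eqP.
Qed.

Lemma entry_pair0 j l l' : (j < 8)%N -> (l < 8)%N -> j != 0 ->
  signed_class j 0 l == [:: (true, l); (false, l')] -> B j l' = B j l.
Proof.
by move=> hj hl j0 /(@entry_pair j 0 l l' hj isT hl j0); rewrite !entry_row0 !subr0.
Qed.

End Entries.

Lemma affine_rigid (R : realType) (A : 'M[R]_8) :
  (forall j, A ord0 j = 0 /\ A j ord0 = 0) ->
  (forall t v, complex_hadamard (phase_mul (S8 R) (t *: A + R8_of v))) ->
  exists a b c d, A = R8 a b c d.
Proof.
move=> A0 HA.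
have row0 := entry_row0 A0; have col0 := entry_col0 A0.
(* Comparison with row 0 leaves three free entries in each of the rows 1, 2, 3, 7, 4 and 5. *)
have e15 : entry A 1 5 = 0
  by rewrite (@entry_pair0 _ _ A0 HA 1 0) ?col0; [|by vm_compute..].
have e14 : entry A 1 4 = entry A 1 1
  by rewrite (@entry_pair0 _ _ A0 HA 1 1) ?col0; [|by vm_compute..].
have e17 : entry A 1 7 = entry A 1 2
  by rewrite (@entry_pair0 _ _ A0 HA 1 2) ?col0; [|by vm_compute..].
have e16 : entry A 1 6 = entry A 1 3
  by rewrite (@entry_pair0 _ _ A0 HA 1 3) ?col0; [|by vm_compute..].
have e25 : entry A 2 5 = 0
  by rewrite (@entry_pair0 _ _ A0 HA 2 0) ?col0; [|by vm_compute..].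
have e24 : entry A 2 4 = entry A 2 1
  by rewrite (@entry_pair0 _ _ A0 HA 2 1) ?col0; [|by vm_compute..].
have e27 : entry A 2 7 = entry A 2 2
  by rewrite (@entry_pair0 _ _ A0 HA 2 2) ?col0; [|by vm_compute..].
have e26 : entry A 2 6 = entry A 2 3
  by rewrite (@entry_pair0 _ _ A0 HA 2 3) ?col0; [|by vm_compute..].
have e33 : entry A 3 3 = 0
  by rewrite (@entry_pair0 _ _ A0 HA 3 0) ?col0; [|by vm_compute..].
have e32 : entry A 3 2 = entry A 3 1
  by rewrite (@entry_pair0 _ _ A0 HA 3 1) ?col0; [|by vm_compute..].
have e37 : entry A 3 7 = entry A 3 4
  by rewrite (@entry_pair0 _ _ A0 HA 3 4) ?col0; [|by vm_compute..].
have e36 : entry A 3 6 = entry A 3 5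
  by rewrite (@entry_pair0 _ _ A0 HA 3 5) ?col0; [|by vm_compute..].
have e73 : entry A 7 3 = 0
  by rewrite (@entry_pair0 _ _ A0 HA 7 0) ?col0; [|by vm_compute..].
have e72 : entry A 7 2 = entry A 7 1
  by rewrite (@entry_pair0 _ _ A0 HA 7 1) ?col0; [|by vm_compute..].
have e77 : entry A 7 7 = entry A 7 4
  by rewrite (@entry_pair0 _ _ A0 HA 7 4) ?col0; [|by vm_compute..].
have e76 : entry A 7 6 = entry A 7 5
  by rewrite (@entry_pair0 _ _ A0 HA 7 5) ?col0; [|by vm_compute..].
have e46 : entry A 4 6 = 0
  by rewrite (@entry_pair0 _ _ A0 HA 4 0) ?col0; [|by vm_compute..].
have e47 : entry A 4 7 = entry A 4 1
  by rewrite (@entry_pair0 _ _ A0 HA 4 1) ?col0; [|by vm_compute..].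
have e44 : entry A 4 4 = entry A 4 2
  by rewrite (@entry_pair0 _ _ A0 HA 4 2) ?col0; [|by vm_compute..].
have e45 : entry A 4 5 = entry A 4 3
  by rewrite (@entry_pair0 _ _ A0 HA 4 3) ?col0; [|by vm_compute..].
have e56 : entry A 5 6 = 0
  by rewrite (@entry_pair0 _ _ A0 HA 5 0) ?col0; [|by vm_compute..].
have e57 : entry A 5 7 = entry A 5 1
  by rewrite (@entry_pair0 _ _ A0 HA 5 1) ?col0; [|by vm_compute..].
have e54 : entry A 5 4 = entry A 5 2
  by rewrite (@entry_pair0 _ _ A0 HA 5 2) ?col0; [|by vm_compute..].
have e55 : entry A 5 5 = entry A 5 3
  by rewrite (@entry_pair0 _ _ A0 HA 5 3) ?col0; [|by vm_compute..].
(* These are positions where [R8 a b c d] has the entries [a], [b], [c] and [d] themselves. *)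
pose a := entry A 1 2; pose b := entry A 3 4.
pose c := entry A 4 1; pose d := entry A 1 1.
have p310 := @entry_pair _ _ HA 3 1 0 1 isT isT isT isT (ltac:(by vm_compute)).
have e31 : entry A 3 1 = d by move: p310; rewrite !col0 /d; clear; lra.
have p312 := @entry_pair _ _ HA 3 1 2 3 isT isT isT isT (ltac:(by vm_compute)).
have e13 : entry A 1 3 = a - d by move: p312; rewrite e32 e31 e33 -/a; clear; lra.
have p314 := @entry_pair _ _ HA 3 1 4 5 isT isT isT isT (ltac:(by vm_compute)).
have e35 : entry A 3 5 = b - d by move: p314; rewrite e14 e15 -/b -/d; clear; lra.
have p320 := @entry_pair _ _ HA 3 2 0 1 isT isT isT isT (ltac:(by vm_compute)).
have e21 : entry A 2 1 = d by move: p320; rewrite !col0 e31; clear; lra.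
have p322 := @entry_pair _ _ HA 3 2 2 3 isT isT isT isT (ltac:(by vm_compute)).
have e23 : entry A 2 3 = entry A 2 2 - d by move: p322; rewrite e32 e31 e33; clear; lra.
(* The comparisons above determine row 2 up to this entry. Rows 1 and 2 of [R8] coincide, so all
   eight columns form one class, which gives the missing equation. Rows 3 and 7, and rows 4 and 5,
   are treated likewise. *)
have e22 : entry A 2 2 = a.
  have := @entry_relation _ _ HA 2 1 0
    [:: (true, 0); (true, 1); (false, 2); (false, 3);
        (true, 4); (true, 5); (false, 6); (false, 7)]%N
    isT isT isT isT (ltac:(by vm_compute)).
  rewrite unlock /= !expr0 !expr1 !col0.
  rewrite e24 e25 e26 e27 e23 e21 e14 e15 e16 e17 e13 -/a -/d; clear; lra.
have p710 := @entry_pair _ _ HA 7 1 0 1 isT isT isT isT (ltac:(by vm_compute)).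
have e71 : entry A 7 1 = d by move: p710; rewrite !col0 -/d; clear; lra.
have p714 := @entry_pair _ _ HA 7 1 4 5 isT isT isT isT (ltac:(by vm_compute)).
have e75 : entry A 7 5 = entry A 7 4 - d by move: p714; rewrite e14 e15 -/d; clear; lra.
have e74 : entry A 7 4 = b.
  have := @entry_relation _ _ HA 7 3 0
    [:: (true, 0); (true, 1); (true, 2); (true, 3);
        (false, 4); (false, 5); (false, 6); (false, 7)]%N
    isT isT isT isT (ltac:(by vm_compute)).
  rewrite unlock /= !expr0 !expr1 !col0.
  rewrite e72 e73 e76 e77 e75 e71 e32 e33 e36 e37 e35 e31 -/b; clear; lra.
have p430 := @entry_pair _ _ HA 4 3 0 2 isT isT isT isT (ltac:(by vm_compute)).
have e42 : entry A 4 2 = d by move: p430; rewrite !col0 e32 e31; clear; lra.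
have p431 := @entry_pair _ _ HA 4 3 1 3 isT isT isT isT (ltac:(by vm_compute)).
have e43 : entry A 4 3 = entry A 4 1 - d by move: p431; rewrite e31 e33; clear; lra.
have p530 := @entry_pair _ _ HA 5 3 0 2 isT isT isT isT (ltac:(by vm_compute)).
have e52 : entry A 5 2 = d by move: p530; rewrite !col0 e32 e31; clear; lra.
have p531 := @entry_pair _ _ HA 5 3 1 3 isT isT isT isT (ltac:(by vm_compute)).
have e53 : entry A 5 3 = entry A 5 1 - d by move: p531; rewrite e31 e33; clear; lra.
have e51 : entry A 5 1 = c.
  have := @entry_relation _ _ HA 5 4 0
    [:: (true, 0); (false, 1); (true, 2); (false, 3);
        (true, 4); (false, 5); (true, 6); (false, 7)]%N
    isT isT isT isT (ltac:(by vm_compute)).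
  rewrite unlock /= !expr0 !expr1 !col0.
  rewrite e54 e55 e56 e57 e53 e52 e44 e45 e46 e47 e43 e42 -/c; clear; lra.
(* Comparisons with rows 1, 3 and 4 reduce row 6 to the single unknown [entry A 6 1]. Rows 0 and 6
   of [R8] both vanish, so their only class has eight columns; its equation makes the unknown 0. *)
have p610 := @entry_pair _ _ HA 6 1 0 5 isT isT isT isT (ltac:(by vm_compute)).
have e65 : entry A 6 5 = 0 by move: p610; rewrite !col0 e15; clear; lra.
have p630 := @entry_pair _ _ HA 6 3 0 3 isT isT isT isT (ltac:(by vm_compute)).
have e63 : entry A 6 3 = 0 by move: p630; rewrite !col0 e33; clear; lra.
have p640 := @entry_pair _ _ HA 6 4 0 6 isT isT isT isT (ltac:(by vm_compute)).
have e66 : entry A 6 6 = 0 by move: p640; rewrite !col0 e46; clear; lra.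
have p611 := @entry_pair _ _ HA 6 1 1 4 isT isT isT isT (ltac:(by vm_compute)).
have e64 : entry A 6 4 = entry A 6 1 by move: p611; rewrite e14; clear; lra.
have p612 := @entry_pair _ _ HA 6 1 2 7 isT isT isT isT (ltac:(by vm_compute)).
have e67 : entry A 6 7 = entry A 6 2 by move: p612; rewrite e17; clear; lra.
have p631 := @entry_pair _ _ HA 6 3 1 2 isT isT isT isT (ltac:(by vm_compute)).
have e62 : entry A 6 2 = entry A 6 1 by move: p631; rewrite e32; clear; lra.
have e61 : entry A 6 1 = 0.
  have := @entry_relation _ _ HA 6 0 0
    [:: (true, 0); (false, 1); (false, 2); (true, 3);
        (false, 4); (true, 5); (true, 6); (false, 7)]%N
    isT isT isT isT (ltac:(by vm_compute)).
  rewrite unlock /= !expr0 !expr1 !col0 !row0 e63 e65 e66 e64 e67 e62; clear; lra.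
exists a, b, c, d; apply/matrixP => j l.
rewrite -(inord_val j) -(inord_val l) -[LHS]/(entry A j l) mxE !inord_val.
by case: j => -[|[|[|[|[|[|[|[|//]]]]]]]] ? /=;
  case: l => -[|[|[|[|[|[|[|[|//]]]]]]]] ? /=;
  rewrite ?row0 ?col0 //
    ?(e15, e14, e17, e16, e13, e25, e24, e27, e26, e23, e22, e21, e33,
    e32, e37, e36, e35, e31, e73, e72, e77, e76, e75, e74, e71, e46, e47,
    e44, e45, e43, e42, e56, e57, e54, e55, e53, e52, e51, e65, e63, e66,
    e64, e67, e62, e61).
Qed.

(** * The parameter space, its dimension and its maximality *)

Definition R8_vec (R : realType) (u : 'rV[R]_4) : 'M[R]_8 := R8_of (u 0).

Fact R8_vec_is_linear (R : realType) : linear (@R8_vec R).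
Proof.
move=> k u v; apply/matrixP => j l; rewrite /R8_vec.
rewrite R8_ofE [RHS]mxE [X in _ = X + _]mxE !R8_ofE mulr_sumr -big_split.
apply: eq_bigr => i _.
by rewrite !mxE /= mulrzDl mulrzAr.
Qed.

HB.instance Definition _ (R : realType) :=
  GRing.isLinear.Build R 'rV[R]_4 'M[R]_8 *:%R (@R8_vec R) (@R8_vec_is_linear R).

Section Space.
Variable R : realType.

Definition R8_space : {vspace 'M[R]_8} := limg (linfun (@R8_vec R)).

Definition param4 (a b c d : R) (i : 'I_4) : R := [:: a; b; c; d]`_i.

Lemma R8_param4 (a b c d : R) : R8 a b c d = R8_of (param4 a b c d).
Proof. by []. Qed.

Lemma mem_R8_space (A : 'M[R]_8) :
  A \in R8_space <-> exists a b c d : R, A = R8 a b c d.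
Proof.
split=> [/memv_imgP[u _ ->]|[a [b [c [d ->]]]]].
  by rewrite lfunE /= /R8_vec /R8_of; do 4!eexists.
have -> : R8 a b c d = linfun (@R8_vec R) (\row_i param4 a b c d i).
  by rewrite lfunE /= /R8_vec R8_param4 /R8_of !mxE.
exact/memv_img/memvf.
Qed.

Lemma R8_of_in (v : 'I_4 -> R) : R8_of v \in R8_space.
Proof. by apply/mem_R8_space; do 4!eexists. Qed.

Lemma dim_R8_space : \dim R8_space = 4%N.
Proof.
rewrite limg_dim_eq ?dimvf //.
apply/eqP; rewrite capfv; apply/eqP.
apply/eqP/lker0P => u v; rewrite !lfunE /= /R8_vec => /matrixP e.
(* Injectivity: the same four positions as in [affine_rigid] recover the parameters. *)
have e0 : u 0 0 = v 0 0 by have := e 1 2%:R; rewrite !mxE.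
have e1 : u 0 1 = v 0 1 by have := e 3%:R 4%:R; rewrite !mxE.
have e2 : u 0 2%:R = v 0 2%:R by have := e 4%:R 1; rewrite !mxE.
have e3 : u 0 3%:R = v 0 3%:R by have := e 1 1; rewrite !mxE.
apply/rowP => -[[|[|[|[|//]]]] lt_i]; [move: e0|move: e1|move: e2|move: e3].
all: by congr (u 0 _ = v 0 _); apply: val_inj.
Qed.

Lemma S8_4_hadamard (a b c d : R) : complex_hadamard (S8_4 a b c d).
Proof. by rewrite /S8_4 R8_param4; apply: complex_hadamard_R8. Qed.

Lemma S8_4_0 : S8_4 0 0 0 0 = S8 R.
Proof.
apply/matrixP => j l; rewrite /S8_4 R8_param4 mxE R8_ofE /eval_form.
by rewrite big1 ?expi0 ?mulr1 // => -[[|[|[|[|//]]]] ?] _; rewrite mul0rz.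
Qed.

Lemma R8_row0_col0 (a b c d : R) (j : 'I_8) :
  R8 a b c d ord0 j = 0 /\ R8 a b c d j ord0 = 0.
Proof.
by rewrite !mxE; case: j => -[|[|[|[|[|[|[|[|//]]]]]]]] ?.
Qed.

Lemma affine_family_R8_space : affine_family (S8 R) R8_space.
Proof.
split.
- by rewrite -S8_4_0; apply: S8_4_hadamard.
- by move=> j; rewrite !mxE; case: j => -[|[|[|[|[|[|[|[|//]]]]]]]] ?.
- by move=> A /mem_R8_space[a [b [c [d ->]]]] j; apply: R8_row0_col0.
- by move=> _ [A /mem_R8_space[a [b [c [d ->]]]] <-]; apply: S8_4_hadamard.
Qed.

(** A larger subspace [W] containing [A] contains every [t *: A + R8_of v], which is what
    [affine_rigid] requires. *)
Lemma maximal_R8_space : maximal_affine_family (S8 R) R8_space.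
Proof.
split=> [|W [_ _ W0 Whad] sVW]; first exact: affine_family_R8_space.
apply/eqP; rewrite eqEsubv sVW andbT; apply/subvP => A AW.
apply/mem_R8_space/affine_rigid => [j|t v]; first exact: W0.
apply: Whad; exists (t *: A + R8_of v) => //=.
by rewrite memvD ?memvZ // (subvP sVW) ?R8_of_in.
Qed.

End Space.

(** * Polynomial obstruction to being Dita-type *)

Section Dita.
Variable R : realType.
Implicit Types K : 'M[R[i]]_8.

Lemma hadamard_equiv_entries N (K1 K2 : 'M[R[i]]_N) : hadamard_equiv K1 K2 ->
  exists (d1 d2 : 'I_N -> R[i]) (s t : 'S_N),
    forall x y, K1 (s x) (t y) = d1 x * K2 x y * d2 y.
Proof.
case=> [D1 [D2 [P1 [P2 [/andP[/diag_mxP[d1 ->] _] /andP[/diag_mxP[d2 ->] _]]]]]].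
move=> /is_perm_mxP[s ->] /is_perm_mxP[t ->] ->.
(* Left multiplication by [perm_mx s] reads row [s x], right multiplication by [perm_mx t] reads
   column [t^-1 y]; hence the inverse on the rows only. *)
exists (fun x => d1 0 (s^-1 x)%g), (fun y => d2 0 (t y)), s^-1%g, t => x y.
rewrite mul_mx_diag mxE -!mulmxA mul_diag_mx mxE mulmxA -row_permE.
by rewrite -[t in perm_mx t]invgK -col_permE !mxE permKV permK.
Qed.

Definition block_index k n N (e : (\sum_(i < k) n)%N = N) (i : 'I_k) (p : 'I_n) :
    'I_N :=
  cast_ord e (@tagnat.Rank k (fun=> n) i p).

Lemma block_index_eq k n N (e : (\sum_(i < k) n)%N = N) i p i' p' :
  (block_index e i p == block_index e i' p') = (i == i') && (p == p').
Proof.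
rewrite /block_index (inj_eq (@cast_ord_inj _ _ e)).
by rewrite -(inj_eq val_inj) tagnat.eq_Rank.
Qed.

Lemma block_indexP k n N (e : (\sum_(i < k) n)%N = N) (x : 'I_N) :
  exists i p, x = block_index e i p.
Proof.
exists (tagnat.sig1 (cast_ord (esym e) x)), (tagnat.sig2 (cast_ord (esym e) x)).
by rewrite /block_index tagnat.sig2K cast_ordKV.
Qed.

Lemma mxblock_block_index k n N (e : (\sum_(i < k) n)%N = N)
    (B : 'I_k -> 'I_k -> 'M[R[i]]_n) i p j q :
  castmx (e, e) (\mxblock_(i < k, j < k) B i j)
    (block_index e i p) (block_index e j q) = B i j p q.
Proof.
rewrite castmxE /block_index !cast_ordK.
by have /matrixP/(_ p q) := mxblockK B i j; rewrite mxE.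
Qed.

(** Multiplying the orthogonality relation by [M 1 0 * M 1 1] removes the conjugates, as entries
    have modulus 1. *)
Lemma complex_hadamard2 (M : 'M[R[i]]_2) : complex_hadamard M ->
  M 0 0 * M 1 1 = - (M 0 1 * M 1 0).
Proof.
case=> nM /(_ 0 1 isT); rewrite dotmx_rowE !big_ord_recl big_ord0 addr0.
have -> : lift ord0 ord0 = 1 :> 'I_2 by apply: val_inj.
have h x y : M x y * conjc (M x y) = 1 by rewrite -sqr_normc nM expr1n.
move=> /(congr1 (fun z => M 1 0 * M 1 1 * z)); rewrite mulr0 mulrDr.
have -> : M 1 0 * M 1 1 * (M 0 ord0 * conjc (M 1 ord0)) =
    M 0 0 * M 1 1 * (M 1 0 * conjc (M 1 0)).
  ring.
have -> : M 1 0 * M 1 1 * (M 0 1 * conjc (M 1 1)) =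
    M 0 1 * M 1 0 * (M 1 1 * conjc (M 1 1)).
  ring.
by rewrite !h !mulr1 => /eqP; rewrite addr_eq0 => /eqP.
Qed.

(** Squaring removes the sign of [complex_hadamard2], so that equal and distinct indices obey one
    equation. *)
Lemma complex_hadamard2_sqr (X : 'M[R[i]]_2) : complex_hadamard X -> forall i j,
  (X 0 i * X 1 j) ^+ 2 = (X 1 i * X 0 j) ^+ 2 /\
  (X i 0 * X j 1) ^+ 2 = (X j 0 * X i 1) ^+ 2.
Proof.
move=> /complex_hadamard2 h.
have o2 (i : 'I_2) : i = 0 \/ i = 1.
  by case: i => -[|[|//]] ?; [left|right]; apply: val_inj.
move=> i j; case: (o2 i) => ->; case: (o2 j) => ->; split.
all: by rewrite ?[X 1 1 * X 0 0]mulrC ?h; ring.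
Qed.

Definition minor_prod (K : 'M[R[i]]_8) (xs : seq ('I_8 * 'I_8)) : R[i] :=
  \prod_(x <- xs) K x.1 x.2.

(* With k = 2 and n = 4, rows (0, p) and (1, p) have, up to a constant, the ratio
   M 0 j / M 1 j at column (j, q), which does not depend on p and takes two opposite
   values; compare p = 0 and p = 1. With k = 4 and n = 2, columns (0, 0) and (0, 1)
   have, up to a constant, the two opposite ratios N p 0 / N p 1 of N = Ns 0 as p
   varies. *)
Lemma dita_type_minors K : dita_type K ->
  (exists r1 r1' r2 r2' : 'I_8, [/\ r1 != r1', r2 != r1, r2 != r1' &
     forall c c',
       minor_prod K [:: (r1, c); (r1, c); (r1', c'); (r1', c')] =
       minor_prod K [:: (r1', c); (r1', c); (r1, c'); (r1, c')] /\
       minor_prod K [:: (r1, c); (r1', c'); (r2', c); (r2, c')] =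
       minor_prod K [:: (r1', c); (r1, c'); (r2, c); (r2', c')]]) \/
  (exists c c' : 'I_8, c != c' /\
     forall r r',
       minor_prod K [:: (r, c); (r, c); (r', c'); (r', c')] =
       minor_prod K [:: (r, c'); (r, c'); (r', c); (r', c)]).
Proof.
case=> k [n [e [M [Ns [k2 n2 hM hN]]]]] /hadamard_equiv_entries[d1 [d2 [s [t hK]]]].
pose row i p := s (block_index e i p); pose col j q := t (block_index e j q).
pose D1 i p := d1 (block_index e i p); pose D2 j q := d2 (block_index e j q).
have KE i p j q : K (row i p) (col j q) =
    D1 i p * (M i j * Ns j p q) * D2 j q.
  by rewrite hK mxblock_block_index mxE.
have row_eq i p i' p' : (row i p == row i' p') = (i == i') && (p == p').
  by rewrite (inj_eq perm_inj) block_index_eq.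
have col_eq i p i' p' : (col i p == col i' p') = (i == i') && (p == p').
  by rewrite (inj_eq perm_inj) block_index_eq.
have rowP x : exists i p, x = row i p.
  have [i [p hx]] := block_indexP e (s^-1 x)%g.
  by exists i, p; rewrite /row -hx permKV.
have colP x : exists i p, x = col i p.
  have [i [p hx]] := block_indexP e (t^-1 x)%g.
  by exists i, p; rewrite /col -hx permKV.
have kn : (k * n = 8)%N by rewrite -e sum_nat_const card_ord.
move: row col D1 D2 KE row_eq col_eq rowP colP.
(* 3 does not divide 8, and [k >= 5] with [n >= 2] would give a product of at least 10. *)
have [[??]|[??]] : k = 2%N /\ n = 4%N \/ k = 4%N /\ n = 2%N.
  clear -kn k2 n2.
  case: k kn k2 => [|[|[|[|[|k]]]]] // kn _; [left|exfalso|right|exfalso].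
  - by split=> //; apply/eqP; rewrite -(eqn_pmul2l (isT : (0 < 2)%N)) kn.
  - by have := dvdn_mulr n (dvdnn 3); rewrite kn.
  - by split=> //; apply/eqP; rewrite -(eqn_pmul2l (isT : (0 < 4)%N)) kn.
  - by have := leq_mul (isT : (5 <= k.+1.+4)%N) n2; rewrite kn.
- subst k n => row col D1 D2 KE row_eq _ _ colP; left.
  exists (row 0 0), (row 1 0), (row 0 1), (row 1 1); split; rewrite ?row_eq // => c c'.
  have [[j [q ->]] [j' [q' ->]]] := (colP c, colP c').
  rewrite /minor_prod !big_cons !big_nil !KE; split; last by ring.
  have [sq _] := complex_hadamard2_sqr hM j j'.
  (* Both sides share the factor [z ^+ 2], because the two rows have the same inner index 0; what
     remains is the square identity for [M]. *)
  pose z := D1 0 0 * Ns j 0 q * D2 j q * (D1 1 0 * Ns j' 0 q' * D2 j' q').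
  transitivity (z ^+ 2 * (M 0 j * M 1 j') ^+ 2); first by rewrite /z; ring.
  by rewrite sq /z; ring.
- subst k n => row col D1 D2 KE _ col_eq rowP _; right.
  exists (col 0 0), (col 0 1); split; rewrite ?col_eq // => r r'.
  have [[i [p ->]] [i' [p' ->]]] := (rowP r, rowP r').
  rewrite /minor_prod !big_cons !big_nil !KE.
  have [_ sq] := complex_hadamard2_sqr (hN 0) p p'.
  pose z := D1 i p * M i 0 * D2 0 0 * (D1 i' p' * M i' 0 * D2 0 1).
  transitivity (z ^+ 2 * (Ns 0 p 0 * Ns 0 p' 1) ^+ 2); first by rewrite /z; ring.
  by rewrite sq /z; ring.
Qed.

(** Factors of modulus 1 make errors add up along a product. *)
Lemma normM_close (x y x' y' : R[i]) : `|x'| = 1 -> `|y| = 1 ->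
  `|x * y - x' * y'| <= `|x - x'| + `|y - y'|.
Proof.
move=> nx ny; have -> : x * y - x' * y' = (x - x') * y + x' * (y - y') by ring.
by apply: le_trans (ler_normD _ _) _; rewrite !normrM nx ny mulr1 mul1r.
Qed.

Definition minor_exp (xs : seq ('I_8 * 'I_8)) : nat :=
  (\sum_(x <- xs) S8_exp x.1 x.2)%N.

(** Finite check that rules out [k = 2], [n = 4] for [S8]. *)
Lemma S8_row_minors (r1 r1' r2 r2' : 'I_8) : r1 != r1' -> r2 != r1 -> r2 != r1' ->
  ~ forall c c' : 'I_8,
      minor_exp [:: (r1, c); (r1, c); (r1', c'); (r1', c')] =
      minor_exp [:: (r1', c); (r1', c); (r1, c'); (r1, c')] %[mod 4] /\
      minor_exp [:: (r1, c); (r1', c'); (r2', c); (r2, c')] =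
      minor_exp [:: (r1', c); (r1, c'); (r2, c); (r2', c')] %[mod 4].
Proof.
(* The nested sums ending in [+ 0] have the shape that [big_cons] and [big_nil] give to
   [minor_exp]. *)
have chk : all (fun r1 => all (fun r1' => all (fun r2 => all (fun r2' : nat =>
    (r1 != r1') ==> (r2 != r1) ==> (r2 != r1') ==>
    ~~ all (fun c => all (fun c' =>
      (S8_exp r1 c + (S8_exp r1 c + (S8_exp r1' c' + (S8_exp r1' c' + 0))) ==
       S8_exp r1' c + (S8_exp r1' c + (S8_exp r1 c' + (S8_exp r1 c' + 0))) %[mod 4])%N &&
      (S8_exp r1 c + (S8_exp r1' c' + (S8_exp r2' c + (S8_exp r2 c' + 0))) ==
       S8_exp r1' c + (S8_exp r1 c' + (S8_exp r2 c + (S8_exp r2' c' + 0))) %[mod 4])%N)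
     (iota 0 8)) (iota 0 8))
    (iota 0 8)) (iota 0 8)) (iota 0 8)) (iota 0 8).
  by vm_compute.
move: chk => /all_ord8P/(_ r1)/all_ord8P/(_ r1')/all_ord8P/(_ r2)/all_ord8P/(_ r2').
move=> + n1 n2 n3 h; rewrite n1 n2 n3 => /all_ord8P[] c; apply/all_ord8P => c'.
have [] := h c c'; rewrite /minor_exp !big_cons !big_nil => e1 e2.
by apply/andP; split; apply/eqP.
Qed.

(** Finite check that rules out [k = 4], [n = 2] for [S8]. *)
Lemma S8_col_minors (c c' : 'I_8) : c != c' ->
  ~ forall r r' : 'I_8,
      minor_exp [:: (r, c); (r, c); (r', c'); (r', c')] =
      minor_exp [:: (r, c'); (r, c'); (r', c); (r', c)] %[mod 4].
Proof.
have chk : all (fun c => all (fun c' : nat => (c != c') ==>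
    ~~ all (fun r => all (fun r' =>
      (S8_exp r c + (S8_exp r c + (S8_exp r' c' + (S8_exp r' c' + 0))) ==
       S8_exp r c' + (S8_exp r c' + (S8_exp r' c + (S8_exp r' c + 0))) %[mod 4])%N)
     (iota 0 8)) (iota 0 8)) (iota 0 8)) (iota 0 8).
  by vm_compute.
move: chk => /all_ord8P/(_ c)/all_ord8P/(_ c').
move=> + ncc' h; rewrite ncc' => /all_ord8P[] r; apply/all_ord8P => r'.
by have := h r r'; rewrite /minor_exp !big_cons !big_nil => e1; apply/eqP.
Qed.

Lemma minor_prod_S8 xs : minor_prod (S8 R) xs = 'i%C ^+ minor_exp xs.
Proof.
rewrite /minor_prod /minor_exp (big_morph _ (exprD 'i%C) (expr0 'i%C)).
by apply: eq_bigr => x _; rewrite S8E.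
Qed.

(* Each of the two products of four entries moves by at most 4/16, and distinct
   powers of i are more than 1 apart. *)
Section Close.
Variables (K : 'M[R[i]]_8).
Hypothesis nK : forall j l, `|K j l| = 1.
Hypothesis K_close : forall j l, `|K j l - S8 R j l| < (16%:R^-1)%:C.

Lemma minor_prod_close xs :
  `|minor_prod K xs - minor_prod (S8 R) xs| <= (16%:R^-1)%:C *+ size xs.
Proof.
elim: xs => [|x xs IH]; first by rewrite /minor_prod !big_nil subrr normr0.
rewrite /minor_prod !big_cons mulrS.
apply: le_trans (normM_close _ _ _ _) _.
- by rewrite S8E normrX norm_i expr1n.
- by rewrite normr_prod big1.
- by rewrite lerD // ltW.
Qed.

Lemma minor_exp_of_prod xs ys : size xs = 4%N -> size ys = 4%N ->
  minor_prod K xs = minor_prod K ys -> minor_exp xs = minor_exp ys %[mod 4].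
Proof.
move=> sx sy e; apply: (@eqmod_of_iX_close R); rewrite -!minor_prod_S8.
have := lerD (minor_prod_close xs) (minor_prod_close ys).
rewrite sx sy -mulrnDr e distrC => h.
apply: le_lt_trans (le_trans _ h) _.
  have -> : minor_prod (S8 R) xs - minor_prod (S8 R) ys =
    (minor_prod (S8 R) xs - minor_prod K ys) +
    (minor_prod K ys - minor_prod (S8 R) ys) by ring.
  exact: ler_normD.
(* The two errors add up to at most 8/16. *)
rewrite -rmorphMn (_ : 1 = 1%:C) // ltcR; lra.
Qed.

Lemma not_dita_close : ~ dita_type K.
Proof.
case/dita_type_minors=> [[r1 [r1' [r2 [r2' [n1 n2 n3 h]]]]]|[c [c' [ncc' h]]]].
  apply: (@S8_row_minors r1 r1' r2 r2') => // c c'.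
  by have [e1 e2] := h c c'; split; apply: minor_exp_of_prod.
by apply: (@S8_col_minors c c') => // r r'; apply: minor_exp_of_prod.
Qed.

End Close.
End Dita.

Theorem mainTheorem3 (R : realType) :
  (exists V : {vspace 'M[R]_8},
     [/\ forall A, A \in V <-> exists a b c d : R, A = R8 a b c d,
         S8_4_family R = affine_set (S8 R) V,
         maximal_affine_family (S8 R) V &
         \dim V = 4%N]) /\
  (forall a b c d : R, complex_hadamard (S8_4 a b c d)) /\
  (exists2 e : R, 0 < e &
     forall K, S8_4_family R K ->
       (forall j l, `|K j l - S8 R j l| < e%:C) -> ~ dita_type K).
Proof.
split; [exists (R8_space R); split|split].
- exact: mem_R8_space.
- apply/seteqP; split=> K /=.
    case=> a [b [c [d ->]]]; exists (R8 a b c d) => //.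
    by apply/mem_R8_space; do 4!eexists.
  by case=> A /mem_R8_space[a [b [c [d ->]]]] <-; exists a, b, c, d.
- exact: maximal_R8_space.
- exact: dim_R8_space.
- exact: S8_4_hadamard.
exists 16%:R^-1; first by rewrite invr_gt0 ltr0n.
move=> _ [a [b [c [d ->]]]] K_close; apply: not_dita_close => // j l.
by have [] := S8_4_hadamard a b c d.
Qed.
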